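(* Let $\varphi\colon\mathbb{R}^n\to\overline{\mathbb{R}}$ be a lower semicontinuous function, and fix $\bar x\in\mathbb{R}^n$ such that $|\varphi(\bar x)|<\infty$ as well as some direction $u\in\mathbb{S}$. Then the first-order growth condition holds for $\varphi$ in direction $u$ at $\bar x$ if and only if $\mathrm{d}\varphi(\bar x)(u)>0$.
   Context: $\overline{\mathbb{R}}:=\mathbb{R}\cup\{-\infty,\infty\}$; $\|\cdot\|$ is the Euclidean norm; $\mathbb{S}:=\{u\in\mathbb{R}^n : \|u\|=1\}$. Directional neighborhoods: for $\varepsilon,\rho>0$ and $u\in\mathbb{R}^n$, $\mathbb{B}_{\varepsilon,\rho}(u):=\{w\in\mathbb{R}^n : \|w\|\le\varepsilon,\ \big\|\|w\|u-\|u\|w\big\|\le\rho\|u\|\|w\|\}$. First-order growth condition: it holds for $\varphi$ in direction $u$ at $\bar x$ if there are $\varepsilon,\rho,\kappa>0$ with $\varphi(x)\ge\varphi(\bar x)+\kappa\|x-\bar x\|$ for all $x\in\bar x+\mathbb{B}_{\varepsilon,\rho}(u)$. First subderivative: $\mathrm{d}\varphi(\bar x)(u):=\liminf_{t\downarrow0,\,u'\to u}\frac{\varphi(\bar x+tu')-\varphi(\bar x)}{t}$. *)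

(* Defs.v *)
From HB Require Import structures.
From mathcomp Require Import all_boot all_order all_algebra.
From mathcomp Require Import all_classical all_reals all_analysis.

Set Implicit Arguments.
Unset Strict Implicit.
Unset Printing Implicit Defensive.

Import Order.TTheory GRing.Theory Num.Theory.
Import numFieldNormedType.Exports.

Local Open Scope classical_set_scope.
Local Open Scope ring_scope.

(* The norm `|x| of MathComp-Analysis on 'rV[R]_n is the sup norm. It induces
   the same topology as the Euclidean norm, so nbhs and lower_semicontinuous
   can be used as they stand, but quantitative conditions need enorm. *)
Definition enorm (R : realType) (n : nat) (x : 'rV[R]_n) : R :=
  Num.sqrt (\sum_(i < n) x ord0 i ^+ 2).

Definition dir_nbhd (R : realType) (n : nat) (eps rho : R) (u : 'rV[R]_n) :
    set 'rV[R]_n :=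
  [set w | enorm w <= eps /\
           enorm (enorm w *: u - enorm u *: w) <= rho * enorm u * enorm w].

Definition first_order_growth (R : realType) (n : nat)
    (phi : 'rV[R]_n -> \bar R) (u xbar : 'rV[R]_n) : Prop :=
  exists eps rho kappa : R,
    [/\ 0 < eps, 0 < rho, 0 < kappa &
        forall x, [set xbar + w | w in dir_nbhd eps rho u] x ->
          (phi xbar + (kappa * enorm (x - xbar))%:E <= phi x)%E].

(* The pair p = (t, u') ranges over the product of the filters t -> 0, t > 0,
   and u' -> u; the value u' = u is not excluded. *)
Definition subderivative (R : realType) (n : nat)
    (phi : 'rV[R]_n -> \bar R) (xbar u : 'rV[R]_n) : \bar R :=
  limf_einf
    (fun p : R * 'rV[R]_n =>
       ((phi (xbar + p.1 *: p.2)%R - phi xbar) * (p.1^-1)%:E)%E)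
    (filter_prod (0 : R)^'+ (nbhs u)).

(* Main.v *)
Require Import Defs.
From HB Require Import structures.
From mathcomp Require Import all_boot all_order all_algebra.
From mathcomp Require Import all_classical all_reals all_analysis.

Set Implicit Arguments.
Unset Strict Implicit.
Unset Printing Implicit Defensive.

Import Order.TTheory GRing.Theory Num.Theory.
Import numFieldNormedType.Exports.

Local Open Scope classical_set_scope.
Local Open Scope ring_scope.

(** Every nonzero displacement w factors as w = t v with t > 0, so growth of phi
    along w is a lower bound on the difference quotient at the pair (t, v):
    since phi xbar is finite,
      k <= (phi (xbar + t v) - phi xbar) / t  iff
      phi xbar + k t <= phi (xbar + t v)     ([le_diff_quotient]).
    A positive subderivative means that some k > 0 bounds the quotients from
    below for all small t > 0 and all v near u ([limf_einf_gt0P]).  What remains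
    is to compare these pairs (t, v) with a directional neighborhood of u, in
    both directions.

    From growth to the subderivative: for v close to u and t small, t v lies in
    the directional neighborhood ([near_dir_nbhd]).  Its norm is t times enorm v,
    not t, but enorm v is close to enorm u = 1, so the growth constant kappa
    still yields the bound kappa / 2 on the quotients.

    From the subderivative to growth: a nonzero w in the directional
    neighborhood is written with t = enorm w and v = w / t.  For this unit v the
    angular condition is exactly a bound on the distance from v to u, so (t, v)
    is one of the controlled pairs once the radii are small ([nbhs_enorm_ball]
    passes from neighborhoods of u to Euclidean balls).  At w = 0 growth holds
    with equality. *)

Lemma enorm_ge0 (R : realType) (n : nat) (x : 'rV[R]_n) : 0 <= enorm x.
Proof. exact: sqrtr_ge0. Qed.

Lemma enormZ (R : realType) (n : nat) (a : R) (x : 'rV[R]_n) :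
  enorm (a *: x) = `|a| * enorm x.
Proof.
rewrite /enorm -sqrtr_sqr -sqrtrM ?sqr_ge0// mulr_sumr.
by congr Num.sqrt; apply: eq_bigr => i _; rewrite mxE exprMn.
Qed.

Lemma enorm0 (R : realType) (n : nat) : enorm (0 : 'rV[R]_n) = 0.
Proof. by rewrite -(scale0r (0 : 'rV_n)) enormZ normr0 mul0r. Qed.

(** This is the half of the equivalence between the sup and Euclidean norms
    that puts Euclidean balls inside the neighborhoods of the sup norm. *)
Lemma coord_le_enorm (R : realType) (n : nat) (x : 'rV[R]_n) (i : 'I_n) :
  `|x ord0 i| <= enorm x.
Proof.
rewrite -sqrtr_sqr ler_wsqrtr// (bigD1 i)//= lerDl.
by apply: sumr_ge0 => j _; exact: sqr_ge0.
Qed.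

Lemma enorm_eq0 (R : realType) (n : nat) (x : 'rV[R]_n) :
  enorm x = 0 -> x = 0.
Proof.
move=> x0; apply/rowP => i; rewrite mxE; apply/eqP.
by rewrite -normr_le0 -x0 coord_le_enorm.
Qed.

Lemma enorm_continuous (R : realType) (n : nat) :
  continuous (@enorm R n).
Proof.
move=> x; rewrite /enorm.
apply: (@continuous_comp _ _ _ (fun y : 'rV[R]_n => \sum_(i < n) y ord0 i ^+ 2)
  Num.sqrt); last exact: sqrt_continuous.
apply: continuous_big => [|i _ y]; first exact: add_continuous.
apply: (@continuous_comp _ _ _ (fun y : 'rV[R]_n => y ord0 i)
  (fun a => a ^+ 2)); [exact: coord_continuous|exact: exprn_continuous].
Qed.

Lemma nbhs_enorm_ball (R : realType) (n : nat) (u : 'rV[R]_n)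
    (V : set 'rV[R]_n) :
  nbhs u V ->
  exists2 r, 0 < r & forall v, enorm (u - v) <= r -> V v.
Proof.
move=> /nbhs_ballP[e /= e0 eV]; exists (e / 2); first by rewrite divr_gt0.
move=> v uv; apply: eV; split=> // i j; rewrite ord1.
have /le_lt_trans : `|(u - v) ord0 j| <= e / 2.
  exact: le_trans (coord_le_enorm _ _) uv.
rewrite !mxE; apply.
by rewrite ltr_pdivrMr// ltr_pMr// ltr1n.
Qed.

(** A positive infimum over a set of the filter may be +oo, in which case any
    real constant is a bound; this is why a real k can always be chosen. *)
Lemma limf_einf_gt0P (T : choiceType) (X : filteredType T) (R : realType)
    (f : X -> \bar R) (F : set (set X)) {FF : Filter F} :
  (0 < limf_einf f F)%E <->
  exists2 k : R, 0 < k & F [set x | (k%:E <= f x)%E].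
Proof.
rewrite limf_einfE; split=> [/ereal_sup_gt[_ [V FV <-]] V0|[k k0 Fk]].
  have [k k0 kV] : exists2 k : R, 0 < k & (k%:E <= ereal_inf (f @` V))%E.
    move: V0; case: (ereal_inf _) => [r r0|_|//].
    - by exists r.
    - by exists 1; rewrite ?leey.
  exists k => //; apply: filterS FV => x Vx; apply: le_trans kV _.
  by apply: ereal_inf_lbound; exists x.
apply: (@lt_le_trans _ _ k%:E); first by rewrite lte_fin.
apply: le_trans (ereal_sup_ubound _); last by exists [set x | (k%:E <= f x)%E].
by apply/ereal_infP => _ [x kx <-].
Qed.

(** Both sides of the angular condition are homogeneous in w, so along t v it
    constrains v alone; t only enters the size condition. *)
Lemma dir_nbhdZ (R : realType) (n : nat) (eps rho t : R) (u v : 'rV[R]_n) :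
  enorm u = 1 -> 0 < t ->
  dir_nbhd eps rho u (t *: v) <->
  t * enorm v <= eps /\ enorm (enorm v *: u - v) <= rho * enorm v.
Proof.
move=> u1 t0; rewrite /dir_nbhd /= enormZ gtr0_norm// u1 scale1r mulr1.
rewrite -scalerA -scalerBr enormZ gtr0_norm// mulrCA ler_pM2l//.
Qed.

Lemma le_diff_quotient (R : realType) (a b : \bar R) (k t : R) :
  a \is a fin_num -> 0 < t ->
  (k%:E <= (b - a) * t^-1%:E)%E = (a + (k * t)%:E <= b)%E.
Proof. by move=> afin t0; rewrite lee_pdivlMr// -EFinM leeBrDl. Qed.

(** The angular condition on v is strict at v = u, where the left side vanishes
    and the right side is rho, so by continuity it persists near u. *)
Lemma near_dir_nbhd (R : realType) (n : nat) (eps rho : R) (u : 'rV[R]_n) :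
  0 < eps -> 0 < rho -> enorm u = 1 ->
  \forall p \near filter_prod (0 : R)^'+ (nbhs u),
    [/\ 0 < p.1, 2^-1 <= enorm p.2 & dir_nbhd eps rho u (p.1 *: p.2)].
Proof.
move=> eps0 rho0 u1.
pose gap (v : 'rV[R]_n) := rho * enorm v - enorm (enorm v *: u - v).
have enorm_u : enorm v @[v --> u] --> enorm u by exact: enorm_continuous.
have gap_cont : gap v @[v --> u] --> gap u.
  have dev_cont : (enorm v *: u - v) @[v --> u] --> enorm u *: u - u.
    exact: cvgB (cvgZr_tmp enorm_u) cvg_id.
  apply: cvgB (cvgMl_tmp enorm_u) _.
  exact: cvg_comp dev_cont (@enorm_continuous R n _).
have gap_u : gap u = rho by rewrite /gap u1 mulr1 scale1r subrr enorm0 subr0.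
have near_gap : \forall v \near u, 0 < gap v.
  by apply: (cvgr_gt (gap u) gap_cont); rewrite gap_u.
have near_half : \forall v \near u, 2^-1 < enorm v.
  by apply: (cvgr_gt _ enorm_u); rewrite u1 invf_lt1// ltr1n.
have near_two : \forall v \near u, enorm v < 2.
  by apply: (cvgr_lt _ enorm_u); rewrite u1 ltr1n.
(* Since enorm v < 2, t < eps / 2 ensures that enorm (t v) <= eps. *)
exists ([set t | 0 < t < eps / 2],
        [set v | [/\ 2^-1 < enorm v, enorm v < 2 & 0 < gap v]]) => /=.
  split; near=> z => /=; last by split; near: z.
  apply/andP; split; near: z; first exact: nbhs_right_gt.
  by apply: nbhs_right_lt; rewrite divr_gt0.
move=> [t v] /= [/andP[t0 te] [v12 v2 gapv]]; split=> //; first exact: ltW.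
apply/dir_nbhdZ => //; split; last by rewrite -subr_ge0 ltW.
rewrite -(divfK (_ : 2 != 0 :> R) eps) ?pnatr_eq0//.
by apply: ler_pM; rewrite ?enorm_ge0 ?ltW.
Unshelve. all: by end_near. Qed.

Theorem lemma3p6 (R : realType) (n : nat) (phi : 'rV[R]_n -> \bar R)
    (xbar u : 'rV[R]_n) :
  lower_semicontinuous phi ->
  (`|phi xbar| < +oo)%E ->
  enorm u = 1 ->
  first_order_growth phi u xbar <-> (0 < subderivative phi xbar u)%E.
Proof.
move=> _; rewrite -ge0_fin_numE ?abse_ge0// abse_fin_num => phi_fin u1.
rewrite /subderivative; split.
  move=> [eps [rho [kappa [eps0 rho0 kappa0 growth]]]].
  apply/limf_einf_gt0P; exists (kappa / 2); first by rewrite divr_gt0.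
  apply: filterS (near_dir_nbhd eps0 rho0 u1) => -[t v] /= [t0 v12 tv].
  rewrite le_diff_quotient//.
  apply: le_trans (growth _ _); last by exists (t *: v).
  rewrite leeD2l// lee_fin (addrC xbar) addrK enormZ gtr0_norm//.
  by rewrite -mulrA ler_pM2l// mulrC ler_pM2l.
move=> /limf_einf_gt0P[k k0 [[Q V] /= [Q0 Vu] QVk]].
have [r r0 rV] := nbhs_enorm_ball Vu.
have [d d0 dQ] : exists2 d, 0 < d & (forall t, 0 < t -> t <= d -> Q t).
  have /nbhs_ballP[e /= e0 eQ] : nbhs (0 : R) [set t | 0 < t -> Q t] := Q0.
  exists (e / 2) => [|t t0 te]; first by rewrite divr_gt0.
  apply: (eQ t) => //; rewrite /ball /= sub0r normrN gtr0_norm//.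
  by apply: le_lt_trans te _; rewrite ltr_pdivrMr// ltr_pMr// ltr1n.
(* With t = enorm w and w / t of norm 1, the size condition reads t <= d and
   the angular one reads enorm (u - w / t) <= r. *)
exists d, r, k; split=> // x [w [wd wr] <-].
rewrite (addrC xbar w) addrK.
have [w0|w_neq0] := eqVneq w 0.
  by rewrite w0 enorm0 mulr0 add0r adde0.
have w_gt0 : 0 < enorm w.
  by rewrite lt0r enorm_ge0 andbT; apply: contra_neq w_neq0 => /enorm_eq0.
pose t := enorm w; pose v := t^-1 *: w.
have tv : w = t *: v by rewrite scalerA divff ?gt_eqF// scale1r.
rewrite -le_diff_quotient//.
have -> : w + xbar = xbar + t *: v by rewrite -tv addrC.
apply: (QVk (t, v)); split=> /=; first exact: dQ.
apply: rV.
have v1 : enorm v = 1 by rewrite enormZ gtr0_norm ?invr_gt0// mulVf ?gt_eqF.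
have [_] : t * enorm v <= d /\ enorm (enorm v *: u - v) <= r * enorm v.
  by apply/(dir_nbhdZ _ _ _ u1 w_gt0); rewrite -tv.
by rewrite v1 scale1r mulr1.
Qed.
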